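(* Let $\mathcal{X}\subseteq\mathbb{R}^N$ and $\mathcal{Z}_m\subseteq\mathbb{R}^{J_m}$, $m\in[M]$, be non-empty, compact and convex. Let $f_0:\mathbb{R}^N\to\mathbb{R}\cup\{+\infty\}$ be convex with $\mathcal{X}\subseteq\mathrm{dom}(f_0)$, and let $g_m:\mathbb{R}^N\times\mathbb{R}^{J_m}\to\mathbb{R}\cup\{\pm\infty\}$, $m\in[M]$, be such that $g_m(\cdot,z_m)$ is convex on $\mathbb{R}^N$ for every $z_m\in\mathcal{Z}_m$, $g_m(x,\cdot)$ is concave on $\mathbb{R}^{J_m}$ for every $x\in\mathcal{X}$, and $\mathcal{X}\times\mathcal{Z}_m\subseteq\mathrm{dom}(g_m)$. Put $f_m(x)=\max_{z_m\in\mathcal{Z}_m}g_m(x,z_m)$. Assume there is $\bar x\in\mathcal{X}$ with $f_m(\bar x)<0$ for all $m\in[M]$, and that the problem $\min\{f_0(x): x\in\mathcal{X},\ f_m(x)\le 0\ \forall m\in[M]\}$ has an optimal solution. Assume further that $f_0$ is differentiable on $\mathcal{X}$, that each $g_m$ is differentiable on $\mathcal{X}\times\mathcal{Z}_m$, and that there are constants $D_0',D_1',\dots,D_M',E_{1,1}',E_{1,2}',\dots,E_{M,1}',E_{M,2}'>0$ such that for all $m\in[M]$, $z_m,z_m'\in\mathcal{Z}_m$, $x,x'\in\mathcal{X}$: $\|\nabla f_0(x)-\nabla f_0(x')\|_2\le D_0'\|x-x'\|_2$, $\|\nabla_x g_m(x,z_m)-\nabla_x g_m(x',z_m)\|_2\le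 D_m'\|x-x'\|_2$, and $\|\nabla_{z_m}g_m(x,z_m)-\nabla_{z_m}g_m(x',z_m')\|_2\le E_{m,1}'\|x-x'\|_2+E_{m,2}'\|z_m-z_m'\|_2$. Let $\alpha>0$, $x^k\in\mathcal{X}$ and $\lambda^{k+1}\in\mathbb{R}^M_+$. Then there exists a constant $C_{i,2}>0$ such that if $T\ge\frac{C_{i,2}}{\nu}$, $$\gamma\le\frac{1}{D_0'+\sum_{m\in[M]}\lambda_m^{k+1}D_m'+\sqrt{2\sum_{m\in[M]}(\lambda_m^{k+1}E_{m,1}')^2}}$$ and $$\delta\le\frac{1}{2\sqrt2\,\big(\max_{m\in[M]}\lambda_m^{k+1}E_{m,2}'\big)+\sqrt{2\sum_{m\in[M]}(\lambda_m^{k+1}E_{m,1}')^2}},$$ then the output $(\bar x_T,\bar z_T)$ of the Inner Algorithm (described in the context) is a strong $\nu$-approximate saddle point (where $\nu>0$) of the inner problem $$\min_{x\in\mathcal{X}}\max_{z\in\mathcal{Z}}\Big\{f_0(x)+\sum_{m\in[M]}\lambda_m^{k+1} g_m(x,z_m)+\frac{1}{2\alpha}\|x-x^k\|_2^2\Big\}.$$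
   Context: Notation: $[M]=\{1,\dots,M\}$; $\mathcal{Z}=\mathcal{Z}_1\times\cdots\times\mathcal{Z}_M$; $\mathrm{Proj}_{\mathcal{S}}$ is Euclidean projection onto a closed convex set $\mathcal{S}$; $\mathrm{dom}$ denotes the domain (the set where a function is finite). A function is differentiable on a non-open set $\mathcal{S}$ if it is differentiable on an open set containing $\mathcal{S}$. Strong approximate saddle point: let $\mathcal{F}:\mathcal{U}\times\mathcal{V}\to\mathbb{R}$ be $\sigma$-strongly convex in $u$ for each $v$ ($\sigma>0$ independent of $v$) and concave in $v$ for each $u$. For $\nu>0$, $(\tilde u,\tilde v)\in\mathcal{U}\times\mathcal{V}$ is a strong $\nu$-approximate saddle point of $\mathcal{F}$ if $\mathcal{F}(\tilde u,v)\le\mathcal{F}(u,\tilde v)-\frac{\sigma}{2}\|u-\tilde u\|_2^2+\nu$ for all $(u,v)\in\mathcal{U}\times\mathcal{V}$. For the inner problem, $\mathcal{F}$ is its objective, $\mathcal{U}=\mathcal{X}$, $\mathcal{V}=\mathcal{Z}$ and $\sigma=1/\alpha$. Inner Algorithm. Input: integer $T\ge1$, step sizes $\delta,\gamma>0$, $x_0\in\mathcal{X}$, $z_0\in\mathcal{Z}$, $\alpha>0$, $x^k\in\mathcal{X}$, $\lambda^{k+1}\ge0$. For $t=0,\dots,T-1$: (z-update) for each $m\in[M]$ compute $\zeta_{t,m}\in\partial_{z_m}(-g_m)(x_t,z_{t,m})$ and set $z_{t+1,m}=\mathrm{Proj}_{\mathcal{Z}_m}(z_{t,m}-\delta\lambda_m^{k+1}(2\zeta_{t,m}-\zeta_{t-1,m}))$,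 where $\zeta_{-1,m}=\zeta_{0,m}$; (x-update) compute $\xi_{t,0}\in\partial f_0(x_t)$ and $\xi_{t,m}\in\partial_x g_m(x_t,z_{t+1,m})$, $m\in[M]$; set $\xi_t=\xi_{t,0}+\sum_{m\in[M]}\lambda_m^{k+1}\xi_{t,m}$ and $x_{t+1}=\mathrm{Proj}_{\mathcal{X}}\big(\frac{\alpha\gamma}{\alpha+\gamma}(\frac1\alpha x^k+\frac1\gamma x_t-\xi_t)\big)$. Here $\partial$ denotes the set of subgradients. Output: $\bar x_T=\frac1T\sum_{t=1}^T x_t$, $\bar z_T=\frac1T\sum_{t=1}^T z_t$.
   Formalization: The constant C_{i,2} may depend on the step sizes γ and δ (but not on ν, T, x_0, z_0 or the subgradients): a constant uniform over all small γ, δ > 0 cannot exist, since for fixed T the iterates barely move as γ tends to 0. *)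

(* Defs.v *)
From HB Require Import structures.
From mathcomp Require Import all_boot all_order all_algebra.
From mathcomp Require Import all_classical all_reals all_analysis.
Import Order.TTheory GRing.Theory Num.Theory.
Import numFieldNormedType.Exports.

Set Implicit Arguments.
Unset Strict Implicit.
Unset Printing Implicit Defensive.

Local Open Scope classical_set_scope.
Local Open Scope ring_scope.

(* The library norm on 'rV[R]_n is the sup norm; it is used below only through
   the topology and differentiability, which do not depend on the norm. *)
Definition enorm (R : realType) (n : nat) (v : 'rV[R]_n) : R :=
  Num.sqrt (\sum_i v 0 i ^+ 2).

Definition dotv (R : realType) (n : nat) (u v : 'rV[R]_n) : R :=
  \sum_i u 0 i * v 0 i.

Definition is_proj (R : realType) (n : nat) (S : set 'rV[R]_n)
    (y p : 'rV[R]_n) : Prop :=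
  S p /\ forall q, S q -> enorm (y - p) <= enorm (y - q).

Definition edom (R : realType) (T : Type) (f : T -> \bar R) : set T :=
  [set x | f x \is a fin_num].

(* Convexity of the epigraph, which makes sense for functions taking both
   infinite values. *)
Definition econvex (R : realType) (n : nat) (f : 'rV[R]_n -> \bar R) : Prop :=
  convex_set [set p : 'rV[R]_n * R^o | (f p.1 <= p.2%:E)%E].

Definition econcave (R : realType) (n : nat) (f : 'rV[R]_n -> \bar R) : Prop :=
  econvex (fun x => - f x)%E.

Definition subdiff (R : realType) (n : nat) (f : 'rV[R]_n -> \bar R)
    (x : 'rV[R]_n) : set 'rV[R]_n :=
  [set xi | forall y, (f x + (dotv xi (y - x))%:E <= f y)%E].

Definition differentiable_on (R : realType) (V : normedModType R)
    (f : V -> \bar R) (S : set V) : Prop :=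
  exists O : set V, [/\ open O, S `<=` O, O `<=` edom f &
    forall x, O x -> differentiable (fun y => fine (f y) : R^o) x].

Definition grad (R : realType) (n : nat) (f : 'rV[R]_n -> \bar R)
    (x : 'rV[R]_n) : 'rV[R]_n :=
  \row_i 'D_(delta_mx 0 i) (fun y => fine (f y) : R^o) x.

(* f_m; the supremum is a maximum when Z is non-empty and compact and
   g x is continuous on Z. *)
Definition max_over (R : realType) (N J : nat)
    (g : 'rV[R]_N -> 'rV[R]_J -> \bar R) (Z : set 'rV[R]_J)
    (x : 'rV[R]_N) : \bar R :=
  ereal_sup [set g x z | z in Z].

Definition feasible (R : realType) (N M : nat) (J : 'I_M -> nat)
    (X : set 'rV[R]_N) (Z : forall m, set 'rV[R]_(J m))
    (g : forall m, 'rV[R]_N -> 'rV[R]_(J m) -> \bar R) : set 'rV[R]_N :=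
  [set x | X x /\ forall m, (max_over (g m) (Z m) x <= 0)%E].

Definition optimal_solution (R : realType) (T : Type) (f : T -> \bar R)
    (S : set T) (xs : T) : Prop :=
  S xs /\ forall x, S x -> (f xs <= f x)%E.

Definition prodset (R : realType) (M : nat) (J : 'I_M -> nat)
    (Z : forall m, set 'rV[R]_(J m)) : set (forall m, 'rV[R]_(J m)) :=
  [set z | forall m, Z m (z m)].

(* F is meant to be sigma-strongly convex in u and concave in v. *)
Definition strong_saddle (R : realType) (n : nat) (V : Type)
    (F : 'rV[R]_n -> V -> R) (sigma : R) (Us : set 'rV[R]_n) (Vs : set V)
    (nu : R) (ut : 'rV[R]_n) (vt : V) : Prop :=
  [/\ Us ut, Vs vt & forall u v, Us u -> Vs v ->
    F ut v <= F u vt - sigma / 2 * enorm (u - ut) ^+ 2 + nu].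

(* fine loses nothing: the objective is only used on the product of X and the
   Z m, where f0 and the g m are finite. *)
Definition inner_objective (R : realType) (N M : nat) (J : 'I_M -> nat)
    (f0 : 'rV[R]_N -> \bar R)
    (g : forall m, 'rV[R]_N -> 'rV[R]_(J m) -> \bar R)
    (alpha : R) (xk : 'rV[R]_N) (lam : 'I_M -> R)
    (x : 'rV[R]_N) (z : forall m, 'rV[R]_(J m)) : R :=
  fine (f0 x) + \sum_(m < M) lam m * fine (g m x (z m))
    + 1 / (2 * alpha) * enorm (x - xk) ^+ 2.

(* x and z are the iterates of a run with T iterations, for some admissible
   choice of subgradients zeta t m, xi0 t and xi t m. Since 0.-1 = 0, the
   convention zeta_{-1} = zeta_0 is built into zeta t.-1. *)
Definition inner_run (R : realType) (N M : nat) (J : 'I_M -> nat)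
    (X : set 'rV[R]_N) (Z : forall m, set 'rV[R]_(J m))
    (f0 : 'rV[R]_N -> \bar R)
    (g : forall m, 'rV[R]_N -> 'rV[R]_(J m) -> \bar R)
    (alpha : R) (xk : 'rV[R]_N) (lam : 'I_M -> R) (gamma delta : R) (T : nat)
    (x : nat -> 'rV[R]_N) (z : nat -> forall m, 'rV[R]_(J m)) : Prop :=
  [/\ X (x 0%N), prodset Z (z 0%N) &
    exists (zeta : nat -> forall m, 'rV[R]_(J m)) (xi0 : nat -> 'rV[R]_N)
           (xi : nat -> 'I_M -> 'rV[R]_N),
    forall t, (t < T)%N ->
      [/\ forall m, subdiff (fun zm => - g m (x t) zm)%E (z t m) (zeta t m),
          forall m, is_proj (Z m)
            (z t m - (delta * lam m) *: (2 *: zeta t m - zeta t.-1 m))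
            (z t.+1 m),
          subdiff f0 (x t) (xi0 t),
          forall m, subdiff (fun y => g m y (z t.+1 m)) (x t) (xi t m) &
          is_proj X
            ((alpha * gamma / (alpha + gamma)) *:
              (alpha^-1 *: xk + gamma^-1 *: x t
                - (xi0 t + \sum_(m < M) lam m *: xi t m)))
            (x t.+1)]].

Definition xavg (R : realType) (N : nat) (T : nat) (x : nat -> 'rV[R]_N) :
    'rV[R]_N :=
  T%:R^-1 *: \sum_(1 <= t < T.+1) x t.

Definition zavg (R : realType) (M : nat) (J : 'I_M -> nat) (T : nat)
    (z : nat -> forall m, 'rV[R]_(J m)) : forall m, 'rV[R]_(J m) :=
  fun m => xavg T (fun t => z t m).

(* Main.v *)
Require Import Defs.
From HB Require Import structures.
From mathcomp Require Import all_boot all_order all_algebra.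
From mathcomp Require Import all_classical all_reals all_analysis.
From mathcomp Require Import ring lra.
Import Order.TTheory GRing.Theory Num.Theory.
Import numFieldNormedType.Exports.
Set Implicit Arguments.
Unset Strict Implicit.
Unset Printing Implicit Defensive.
Local Open Scope classical_set_scope.
Local Open Scope ring_scope.

(* Let L be the objective and zeta_t = - grad_z g (x_t, z_t); the given
   subgradients are the gradients, since the functions are differentiable.
   Fix a comparison point (u, v). The projection inequalities, the descent
   inequality in x (whose constant is the Lipschitz constant of the gradient
   of the Lagrangian) and concavity in z bound
     L (x_(t+1), v) - L (u, z_(t+1)) + |u - x_(t+1)|^2 / (2 alpha)
   by telescoping terms plus
     - sum_m lam_m <zeta_t - zeta_(t-1), z_(t+1) - z_t>_m,
   the error of the extrapolation 2 zeta_t - zeta_(t-1). By the Lipschitz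
   bound on zeta and Young's inequality this error is absorbed by the squared
   lengths of the steps t and t + 1, which the step size conditions make
   available. Summing over t leaves a constant determined by the diameters
   of X and Z_m (and the parameters), and averaging divides it by T. *)

(** * Euclidean inner product and norm on row vectors *)

Section Euclidean.
Context {R : realType} {n : nat}.
Implicit Types (u v w a b c : 'rV[R]_n) (k : R).

Lemma dotvC u v : dotv u v = dotv v u.
Proof. by apply: eq_bigr => i _; rewrite mulrC. Qed.

Lemma dotvDl u v w : dotv (u + v) w = dotv u w + dotv v w.
Proof. by rewrite -big_split; apply: eq_bigr => i _; rewrite mxE mulrDl. Qed.

Lemma dotvDr u v w : dotv w (u + v) = dotv w u + dotv w v.
Proof. by rewrite dotvC dotvDl !(dotvC w). Qed.

Lemma dotvZl k u v : dotv (k *: u) v = k * dotv u v.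
Proof.
by rewrite /dotv mulr_sumr; apply: eq_bigr => i _; rewrite mxE mulrA.
Qed.

Lemma dotvZr k u v : dotv u (k *: v) = k * dotv u v.
Proof. by rewrite dotvC dotvZl dotvC. Qed.

Lemma dotvNl u v : dotv (- u) v = - dotv u v.
Proof. by rewrite -scaleN1r dotvZl mulN1r. Qed.

Lemma dotvNr u v : dotv u (- v) = - dotv u v.
Proof. by rewrite dotvC dotvNl dotvC. Qed.

Lemma dotv0l u : dotv 0 u = 0.
Proof. by rewrite -(scale0r 0) dotvZl mul0r. Qed.

Lemma dotv_suml (I : Type) (r : seq I) (F : I -> 'rV[R]_n) v :
  dotv (\sum_(i <- r) F i) v = \sum_(i <- r) dotv (F i) v.
Proof.
elim/big_rec2: _ => [|i y x _ <-]; first exact: dotv0l.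
by rewrite dotvDl.
Qed.

Definition dotvE :=
  (dotvDl, dotvDr, dotvNl, dotvNr, dotvZl, dotvZr).

Lemma dotvv_ge0 u : 0 <= dotv u u.
Proof. by apply: sumr_ge0 => i _; rewrite -expr2 sqr_ge0. Qed.

Lemma dotvv_eq0 u : dotv u u = 0 -> u = 0.
Proof.
move=> /eqP; rewrite psumr_eq0 => [|i _]; last by rewrite -expr2 sqr_ge0.
move=> /allP u0; apply/rowP => i; rewrite mxE.
by have /= := u0 i (mem_index_enum i); rewrite -expr2 sqrf_eq0 => /eqP.
Qed.

Lemma enorm_sq u : enorm u ^+ 2 = dotv u u.
Proof.
rewrite sqr_sqrtr; last by apply: sumr_ge0 => i _; exact: sqr_ge0.
by apply: eq_bigr => i _; rewrite expr2.
Qed.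

Lemma enorm_ge0 u : 0 <= enorm u.
Proof. exact: sqrtr_ge0. Qed.

Lemma enorm_sq_le u k : enorm u <= k -> enorm u ^+ 2 <= k ^+ 2.
Proof.
move=> uk; rewrite ler_pXn2r ?nnegrE ?enorm_ge0//.
exact: le_trans (enorm_ge0 u) uk.
Qed.

Lemma enorm0 : enorm (0 : 'rV[R]_n) = 0.
Proof. by apply/eqP; rewrite -sqrf_eq0 enorm_sq dotv0l. Qed.

Lemma enormN u : enorm (- u) = enorm u.
Proof. by congr Num.sqrt; apply: eq_bigr => i _; rewrite mxE sqrrN. Qed.

Lemma enormZ k u : 0 <= k -> enorm (k *: u) = k * enorm u.
Proof.
move=> k0; apply/eqP; rewrite -(@eqrXn2 _ 2) ?mulr_ge0 ?enorm_ge0//.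
by rewrite enorm_sq exprMn enorm_sq dotvZl dotvZr mulrA expr2.
Qed.

(** Cauchy-Schwarz, from the nonnegative square of |v|^2 u - <u, v> v, a multiple of the part of [u]
    orthogonal to [v]; the case v = 0 is separate. *)
Lemma dotv_le u v : dotv u v <= enorm u * enorm v.
Proof.
apply: le_trans (ler_norm _) _.
rewrite -(@ler_pXn2r _ 2) ?nnegrE ?mulr_ge0 ?enorm_ge0//.
rewrite exprMn !enorm_sq real_normK ?num_real//.
have [v0|v0] := eqVneq (dotv v v) 0.
  by rewrite (dotvv_eq0 v0) (dotvC u) !dotv0l expr0n mulr0.
have vp : 0 < dotv v v by rewrite lt0r v0 dotvv_ge0.
have := dotvv_ge0 (dotv v v *: u - dotv u v *: v).
rewrite !dotvE (dotvC v u) -(pmulr_rge0 _ vp) => H.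
rewrite -subr_ge0 -(pmulr_rge0 _ vp) -(pmulr_rge0 _ vp).
by apply: le_trans H _; rewrite le_eqVlt; apply/orP; left; apply/eqP; ring.
Qed.

Lemma enormD_le u v : enorm (u + v) <= enorm u + enorm v.
Proof.
rewrite -(@ler_pXn2r _ 2) ?nnegrE ?addr_ge0 ?enorm_ge0//.
rewrite sqrrD !enorm_sq !dotvE (dotvC v u).
by have := dotv_le u v; lra.
Qed.

(** Polarization; it turns the projection inequalities into differences of squared distances, which
    telescope along the iteration. *)
Lemma dotv_three_points a b c :
  2 * dotv (c - b) (a - c) =
    enorm (a - b) ^+ 2 - enorm (a - c) ^+ 2 - enorm (c - b) ^+ 2.
Proof.
rewrite !enorm_sq !dotvE (dotvC b a) (dotvC c a) (dotvC c b); ring.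
Qed.

End Euclidean.

(** * Convex sets: segments, averages and Euclidean projections *)

Section Convexity.
Context {R : realType}.

Lemma convex_segment (V : lmodType R) (A : set V) (a b : V) (s : R) :
  convex_set A -> A a -> A b -> 0 <= s -> s <= 1 -> A (a + s *: (b - a)).
Proof.
move=> cA Aa Ab s0 s1.
have /set_mem := cA b a (Itv01 s0 s1) (mem_set Ab) (mem_set Aa).
rewrite /conv /= /unstable.onem.
by congr A; rewrite scalerBr scalerBl scale1r addrC addrAC addrA.
Qed.

(** Induction on the number of points: each new average lies on the segment from the previous
    average to the new point. *)
Lemma convex_xavg n (A : set 'rV[R]_n) (T : nat) (x : nat -> 'rV[R]_n) :
  convex_set A -> (0 < T)%N -> (forall t, (0 < t <= T)%N -> A (x t)) ->
  A (xavg T x).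
Proof.
move=> cA; elim: T => [//|[_ _ Ax|T IH _ Ax]].
  by rewrite /xavg big_nat1 invr1 scale1r; exact: Ax.
have AT : A (xavg T.+1 x).
  by apply: IH => // t /andP[t0 tT]; apply: Ax; rewrite t0 ltnW.
have -> : xavg T.+2 x =
    xavg T.+1 x + T.+2%:R^-1 *: (x T.+2 - xavg T.+1 x).
  rewrite /xavg big_nat_recr//= scalerDr scalerBr addrCA addrC; congr (_ + _).
  rewrite scalerA -scalerBl; congr (_ *: _).
  have T1 : T.+1%:R != 0 :> R by rewrite pnatr_eq0.
  have T2 : T.+2%:R != 0 :> R by rewrite pnatr_eq0.
  move: T1 T2; rewrite -[T.+2%:R]natr1; move: (T.+1%:R) => k k0 k1.
  by field; rewrite k0 k1.
apply: convex_segment => //; first by apply: Ax; rewrite /= leqnn.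
by rewrite invf_le1 ?ler1n ?ltr0n.
Qed.

(** Variational inequality of the projection: moving from [p] a fraction [s] of the way to [q]
    cannot bring the point closer to [y], and the first-order term in [s] decides. *)
Lemma is_proj_dotv n (S : set 'rV[R]_n) (y p q : 'rV[R]_n) :
  convex_set S -> is_proj S y p -> S q -> dotv (y - p) (q - p) <= 0.
Proof.
move=> cS [Sp pmin] Sq.
have key s : 0 < s -> s <= 1 ->
    2 * dotv (y - p) (q - p) <= s * enorm (q - p) ^+ 2.
  move=> s0 s1.
  have := pmin _ (convex_segment cS Sp Sq (ltW s0) s1).
  rewrite -(@ler_pXn2r _ 2) ?nnegrE ?enorm_ge0//.
  rewrite (_ : y - (p + s *: (q - p)) = (y - p) - s *: (q - p)); last first.
    by rewrite opprD addrA.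
  rewrite !enorm_sq; move: (y - p) (q - p) => u v.
  rewrite dotvDl !dotvDr !dotvNr !dotvNl !dotvZl !dotvZr (dotvC v u) => H.
  by rewrite -(ler_pM2l s0); lra.
have q0 := sqr_ge0 (enorm (q - p)).
rewrite leNgt; apply/negP => d0.
set d := dotv _ _ in key d0; set e := enorm _ ^+ 2 in key q0.
(* This [s] lies in (0, 1] even when e = 0, and [key] at [s] would give 2 d (d + e) <= d e, which is
   false for d > 0. *)
have sp : 0 < d / (d + e) by rewrite divr_gt0 ?ltr_wpDr.
have s1 : d / (d + e) <= 1 by rewrite ler_pdivrMr ?ltr_wpDr// mul1r lerDl.
have := key _ sp s1; rewrite mulrAC ler_pdivlMr ?ltr_wpDr// => H.
by have := mulr_gt0 d0 d0; have := mulr_ge0 (ltW d0) q0; lra.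
Qed.

End Convexity.

(** * Gradients and subgradients of extended-real functions *)

Section Gradient.
Context {R : realType} {n : nat}.
Variables (f : 'rV[R]_n -> \bar R) (x : 'rV[R]_n).
Hypothesis f_fin : \forall y \near x, f y \is a fin_num.
Hypothesis f_diff : differentiable (fun y => fine (f y) : R^o) x.

Lemma dotv_grad v : dotv (grad f x) v = 'D_v (fun y => fine (f y) : R^o) x.
Proof.
rewrite (deriveE _ f_diff) [in RHS](row_sum_delta v) linear_sum.
by apply: eq_bigr => i _; rewrite mxE linearZ deriveE// mulrC.
Qed.

(** A right-hand limit is all that is taken below: dividing an inequality by [s > 0] keeps its
    direction. *)
Lemma grad_cvg v :
  (fun s : R => s^-1 * (fine (f (s *: v + x)) - fine (f x))) @ 0^'+
    --> dotv (grad f x) v.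
Proof.
apply: cvg_dnbhs_at_right; rewrite dotv_grad.
exact: (diff_derivable (v := v) f_diff).
Qed.

Lemma near_right_fin v :
  \forall s \near (0 : R)^'+, f (s *: v + x) \is a fin_num.
Proof.
have c : s *: v + x @[s --> (0 : R)^'+] --> x.
  apply: cvg_at_right_filter.
  rewrite -[X in _ --> X]add0r -[X in X + _](scale0r v).
  by apply: cvgD; [exact: cvgZr_tmp|exact: cvg_cst].
exact: c f_fin.
Qed.

(** The segment between the graph points over [x] and [y] stays in the epigraph, so the difference
    quotients at [x] towards [y] are at most f(y) - f(x); then [s] tends to 0. *)
Lemma econvex_grad_le y : econvex f -> f y \is a fin_num ->
  fine (f x) + dotv (grad f x) (y - x) <= fine (f y).
Proof.
move=> cf fy; rewrite addrC -lerBrDr.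
have fx : f x \is a fin_num := nbhs_singleton f_fin.
apply: cvgr_to_le (@grad_cvg (y - x)) _.
near=> s.
have s0 : 0 < s by near: s; exact: nbhs_right_gt.
have s1 : s <= 1 by near: s; exact: nbhs_right_le.
have fs : f (s *: (y - x) + x) \is a fin_num.
  by near: s; exact: near_right_fin.
have := @convex_segment _ _ _ (x, fine (f x) : R^o) (y, fine (f y) : R^o) s cf.
rewrite /= !fineK// => /(_ (lexx _) (lexx _) (ltW s0) s1).
rewrite addrC -[in leLHS](fineK fs) lee_fin => H.
by rewrite ler_pdivrMl// lerBlDl.
Unshelve. all: by end_near. Qed.

(** Along every ray the subgradient inequality bounds [dotv xi v] by the directional derivative,
    which is linear in [v]; this forces equality. *)
Lemma subdiff_grad xi : subdiff f x xi -> xi = grad f x.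
Proof.
move=> sub.
have fx : f x \is a fin_num := nbhs_singleton f_fin.
have dir v : dotv xi v <= dotv (grad f x) v.
  apply: cvgr_to_ge (@grad_cvg v) _.
  near=> s.
  have s0 : 0 < s by near: s; exact: nbhs_right_gt.
  have fs : f (s *: v + x) \is a fin_num by near: s; exact: near_right_fin.
  have := sub (s *: v + x).
  rewrite -(fineK fs) -(fineK fx) -EFinD lee_fin addrK dotvZr => H.
  by rewrite ler_pdivlMl// lerBrDl.
(* For [v = xi - grad f x], [dir] says that the squared length of [v] is at most 0. *)
apply/eqP; rewrite -subr_eq0; apply/eqP/dotvv_eq0/le_anti.
rewrite dotvv_ge0 andbT.
by rewrite [leLHS]dotvDl dotvNl subr_le0.
Unshelve. all: by end_near. Qed.

End Gradient.

(** * Descent inequality, Jensen's inequality and bounded diameters *)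

Section GradientInequality.
Context {R : realType} {n : nat}.

(* Splitting the segment at its midpoint replaces a quadratic error [c] by
   [c / 2 + D / 4]; iterating from [c = D] converges to [D / 2]. *)
Lemma descent_le (X : set 'rV[R]_n) (p : 'rV[R]_n -> R)
    (P : 'rV[R]_n -> 'rV[R]_n) (D : R) :
  convex_set X ->
  (forall x y, X x -> X y -> p x + dotv (P x) (y - x) <= p y) ->
  (forall x y, X x -> X y -> enorm (P x - P y) <= D * enorm (x - y)) ->
  forall x y, X x -> X y ->
    p y <= p x + dotv (P x) (y - x) + D / 2 * enorm (y - x) ^+ 2.
Proof.
move=> cX subP lipP.
have lip x y : X x -> X y -> dotv (P y - P x) (y - x) <= D * enorm (y - x) ^+ 2.
  move=> Xx Xy; apply: le_trans (dotv_le _ _) _.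
  by rewrite expr2 mulrA ler_wpM2r ?enorm_ge0// lipP.
have step k : forall x y, X x -> X y ->
    p y <= p x + dotv (P x) (y - x)
           + (D / 2 + D / 2 / 2 ^+ k) * enorm (y - x) ^+ 2.
  elim: k => [|k IH] x y Xx Xy.
    have := subP _ _ Xy Xx; have := lip _ _ Xx Xy.
    rewrite -[x - y]opprB dotvNr dotvDl dotvNl expr0 divr1.
    by set e := enorm _ ^+ 2; lra.
  set c := x + 2^-1 *: (y - x).
  have Xc : X c by apply: convex_segment => //; lra.
  have cx : c - x = 2^-1 *: (y - x) by rewrite /c addrAC subrr add0r.
  have yc : y - c = 2^-1 *: (y - x).
    rewrite /c opprD addrA -[X in X - _]scale1r -scalerBl; congr (_ *: _).
    lra.
  have := IH _ _ Xx Xc; have := IH _ _ Xc Xy; have := lip _ _ Xx Xc.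
  rewrite cx yc enormZ ?invr_ge0 ?ler0n// !dotvZr dotvDl dotvNl exprMn.
  rewrite [2 ^+ k.+1]exprS invfM.
  by move: (2 ^+ k)^-1 (enorm _ ^+ 2) => w e; lra.
move=> x y Xx Xy; rewrite leNgt; apply/negP; rewrite -subr_gt0.
set d := _ - _ => d0; set e := D / 2 * enorm (y - x) ^+ 2.
have small k : d * 2 ^+ k <= e.
  rewrite -ler_pdivlMr ?exprn_gt0// /d /e.
  have := step k _ _ Xx Xy.
  by move: (2 ^+ k)^-1 (enorm _ ^+ 2) => w a; lra.
have := small (Num.truncn (e / d)).+1; rewrite leNgt => /negP; apply.
rewrite -ltr_pdivrMl// mulrC; apply: lt_trans (truncnS_gt (e / d)) _.
by rewrite -natrX ltr_nat ltn_expl.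
Qed.

(** Jensen's inequality from one supporting affine function at the average: its linear terms cancel,
    since deviations from the average sum to 0. *)
Lemma avg_grad_le (p : 'rV[R]_n -> R) (v : 'rV[R]_n) (T : nat)
    (x : nat -> 'rV[R]_n) : (0 < T)%N ->
  (forall t, (0 < t <= T)%N ->
     p (xavg T x) + dotv v (x t - xavg T x) <= p (x t)) ->
  T%:R * p (xavg T x) <= \sum_(1 <= t < T.+1) p (x t).
Proof.
move=> T0 sub.
have sum0 : \sum_(1 <= t < T.+1) dotv v (x t - xavg T x) = 0.
  rewrite (eq_bigr (fun t => dotv (x t - xavg T x) v)) => [|t _]; last first.
    exact: dotvC.
  rewrite -dotv_suml sumrB sumr_const_nat subSS subn0.
  rewrite -scaler_nat scalerA divff ?scale1r ?subrr ?dotv0l//.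
  by rewrite pnatr_eq0 -lt0n.
have -> : T%:R * p (xavg T x) =
    \sum_(1 <= t < T.+1) (p (xavg T x) + dotv v (x t - xavg T x)).
  by rewrite big_split/= sumr_const_nat subSS subn0 mulr_natl sum0 addr0.
by apply: ler_sum_nat => t tT; apply: sub.
Qed.

Lemma compact_enorm_bounded (A : set 'rV[R]_n) : compact A ->
  exists2 d, 0 <= d & forall x y, A x -> A y -> enorm (x - y) <= d.
Proof.
move=> /compact_bounded [B [_ AB]].
have {}AB x : A x -> `|x| <= `|B| + 1.
  by apply: AB; rewrite (le_lt_trans (ler_norm B))// ltrDl.
set b := `|B| + 1 in AB; exists (2 * Num.sqrt (n%:R * b ^+ 2)).
  by rewrite mulr_ge0// sqrtr_ge0.
(* [b] bounds the sup norm, hence each of the [n] coordinates. *)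
have bound x : A x -> enorm x <= Num.sqrt (n%:R * b ^+ 2).
  move=> Ax; rewrite ler_sqrt; last by rewrite mulr_ge0 ?sqr_ge0.
  rewrite -[X in X%:R]card_ord -sum1_card natr_sum mulr_suml.
  apply: ler_sum => i _; rewrite mul1r -real_normK ?num_real//.
  rewrite ler_pXn2r ?nnegrE ?normr_ge0//; last by rewrite addr_ge0.
  apply: le_trans (AB _ Ax).
  rewrite [leRHS]/Num.Def.normr/= mx_normrE; apply/bigmax_geP; right.
  by exists (ord0, i).
move=> x y Ax Ay; apply: le_trans (enormD_le _ _) _; rewrite enormN.
by rewrite mulr_natl mulr2n lerD// bound.
Qed.

End GradientInequality.

(** * The primal-dual iteration for real-valued functions with abstract gradients *)

Section PrimalDual.
Context {R : realType} {N M : nat} {J : 'I_M -> nat}.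
Context {X : set 'rV[R]_N} {Z : forall m, set 'rV[R]_(J m)}.
Arguments Z : clear implicits.
Context {p : 'rV[R]_N -> R} {G : 'rV[R]_N -> 'rV[R]_N}.
Context {h : forall m, 'rV[R]_N -> 'rV[R]_(J m) -> R}.
Context {Hx : forall m, 'rV[R]_N -> 'rV[R]_(J m) -> 'rV[R]_N}.
Context {Hz : forall m, 'rV[R]_N -> 'rV[R]_(J m) -> 'rV[R]_(J m)}.
Context {D0 : R} {D E1 E2 lam : 'I_M -> R}.
Context {alpha gamma delta S E : R} {xk : 'rV[R]_N}.

Hypothesis X_convex : convex_set X.
Hypothesis Z_convex : forall m, convex_set (Z m).
Hypothesis p_sub : forall x y, X x -> X y -> p x + dotv (G x) (y - x) <= p y.
Hypothesis h_sub : forall m z x y, Z m z -> X x -> X y ->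
  h x z + dotv (Hx x z) (y - x) <= h y z.
Hypothesis h_sup : forall m x z w, X x -> Z m z -> Z m w ->
  h x w <= h x z + dotv (Hz x z) (w - z).
Hypothesis G_lip : forall x y, X x -> X y ->
  enorm (G x - G y) <= D0 * enorm (x - y).
Hypothesis Hx_lip : forall m z x y, Z m z -> X x -> X y ->
  enorm (Hx x z - Hx y z) <= D m * enorm (x - y).
Hypothesis Hz_lip : forall m z w x y, Z m z -> Z m w -> X x -> X y ->
  enorm (Hz x z - Hz y w) <= E1 m * enorm (x - y) + E2 m * enorm (z - w).
Hypothesis E1_ge0 : forall m, 0 <= E1 m.
Hypothesis E2_ge0 : forall m, 0 <= E2 m.
Hypothesis lam_ge0 : forall m, 0 <= lam m.
Hypothesis alpha_gt0 : 0 < alpha.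
Hypothesis gamma_gt0 : 0 < gamma.
Hypothesis delta_gt0 : 0 < delta.
Hypothesis S_def : S = Num.sqrt (\sum_(m < M) (lam m * E1 m) ^+ 2).
Hypothesis E_ge : forall m, lam m * E2 m <= E.
(* [sqrt (2 * \sum_m _)] is replaced by the smaller [S], and
   [2 * sqrt 2 * max_m _] by [2 * E]; the weaker bounds are enough. *)
Hypothesis gamma_small : gamma * (D0 + \sum_(m < M) lam m * D m + S) <= 1.
Hypothesis delta_small : delta * (2 * E + S) <= 1.

Let L x (z : forall m, 'rV[R]_(J m)) :=
  p x + \sum_(m < M) lam m * h x (z m) + 1 / (2 * alpha) * enorm (x - xk) ^+ 2.

Lemma coupled_sub z x y : prodset Z z -> X x -> X y ->
  p x + \sum_(m < M) lam m * h x (z m)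
    + dotv (G x + \sum_(m < M) lam m *: Hx x (z m)) (y - x) <=
  p y + \sum_(m < M) lam m * h y (z m).
Proof.
move=> Zz Xx Xy.
rewrite dotvDl dotv_suml addrACA lerD ?p_sub// -big_split/= ler_sum// => m _.
by rewrite dotvZl -mulrDr ler_wpM2l// h_sub.
Qed.

(** For fixed [z] the Lagrangian has a gradient in [x] whose Lipschitz constant, by the triangle
    inequality, is D0 plus the weighted sum of the D_m. *)
Lemma coupled_descent_le z x y : prodset Z z -> X x -> X y ->
  p y + \sum_(m < M) lam m * h y (z m) <=
  p x + \sum_(m < M) lam m * h x (z m)
    + dotv (G x + \sum_(m < M) lam m *: Hx x (z m)) (y - x)
    + (D0 + \sum_(m < M) lam m * D m) / 2 * enorm (y - x) ^+ 2.
Proof.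
move=> Zz; move: x y.
apply: (descent_le (p := fun x => p x + \sum_(m < M) lam m * h x (z m))
  (P := fun x => G x + \sum_(m < M) lam m *: Hx x (z m))) => // x y Xx Xy.
  exact: coupled_sub.
rewrite opprD addrACA -sumrB mulrDl mulr_suml.
apply: le_trans (enormD_le _ _) _; rewrite lerD ?G_lip//.
elim/big_rec2: _ => [|m a b _ ab]; first by rewrite enorm0.
apply: le_trans (enormD_le _ _) _; rewrite lerD//.
by rewrite -scalerBr enormZ// -mulrA ler_wpM2l// Hx_lip.
Qed.

(** Cauchy-Schwarz over the blocks [m], against the vector of the [lam m * E1 m], whose norm is [S],
    followed by 2 a |b| <= a^2 + |b|^2. *)
Lemma cross_term_le (a : R) (b : 'I_M -> R) : 0 <= a ->
  \sum_(m < M) lam m * E1 m * a * b m <=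
  S / 2 * (a ^+ 2 + \sum_(m < M) b m ^+ 2).
Proof.
move=> a0; pose u : 'rV[R]_M := \row_m (lam m * E1 m).
pose v : 'rV[R]_M := \row_m b m.
have -> : \sum_(m < M) lam m * E1 m * a * b m = a * dotv u v.
  by rewrite mulr_sumr; apply: eq_bigr => m _; rewrite !mxE; ring.
have -> : \sum_(m < M) b m ^+ 2 = enorm v ^+ 2.
  by rewrite enorm_sq; apply: eq_bigr => m _; rewrite mxE expr2.
have -> : S = enorm u.
  by rewrite S_def; congr Num.sqrt; apply: eq_bigr => m _; rewrite mxE.
apply: le_trans (ler_wpM2l a0 (dotv_le u v)) _.
have := mulr_ge0 (enorm_ge0 u) (sqr_ge0 (a - enorm v)).
by rewrite sqrrB; lra.
Qed.

Section Run.
Context {T : nat} {x : nat -> 'rV[R]_N} {z : nat -> forall m, 'rV[R]_(J m)}.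
Hypothesis Xx : forall t, (t <= T)%N -> X (x t).
Hypothesis Zz : forall t, (t <= T)%N -> prodset Z (z t).

Let zeta t m := - Hz (x t) (z t m).

Hypothesis z_step : forall t m, (t < T)%N -> is_proj (Z m)
  (z t m - (delta * lam m) *: (2 *: zeta t m - zeta t.-1 m)) (z t.+1 m).
Hypothesis x_step : forall t, (t < T)%N -> is_proj X
  ((alpha * gamma / (alpha + gamma)) *:
     (alpha^-1 *: xk + gamma^-1 *: x t
      - (G (x t) + \sum_(m < M) lam m *: Hx (x t) (z t.+1 m)))) (x t.+1).

(** Since [0.-1 = 0], [dx], [dz] and [W] all vanish at t = 0, so the telescoped sum starts without
    extrapolation error. *)
Let dx t := enorm (x t - x t.-1).
Let dz t m := enorm (z t m - z t.-1 m).
Let W (v : forall m, 'rV[R]_(J m)) t m :=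
  dotv (zeta t m - zeta t.-1 m) (z t m - v m).

Lemma zeta_lip t m : (t <= T)%N ->
  enorm (zeta t m - zeta t.-1 m) <= E1 m * dx t + E2 m * dz t m.
Proof.
move=> tT; have t'T : (t.-1 <= T)%N by apply: leq_trans (leq_pred _) tT.
rewrite -opprD enormN.
by apply: Hz_lip; [exact: Zz|exact: Zz|exact: Xx|exact: Xx].
Qed.

(** Concavity at z_(t+1) leaves <zeta_(t+1), z_(t+1) - v>. Subtracting the direction 2 zeta_t -
    zeta_(t-1) of the projection step gives W_(t+1) - W_t - <zeta_t - zeta_(t-1), z_(t+1) - z_t>,
    and only the last product has to be estimated. *)
Lemma dual_step v t m : prodset Z v -> (t < T)%N ->
  lam m * (h (x t.+1) (v m) - h (x t.+1) (z t.+1 m)) <=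
    1 / (2 * delta) * (enorm (v m - z t m) ^+ 2 - enorm (v m - z t.+1 m) ^+ 2
                       - dz t.+1 m ^+ 2)
    + lam m * (W v t.+1 m - W v t m)
    + lam m * E1 m * dx t * dz t.+1 m
    + E / 2 * (dz t m ^+ 2 + dz t.+1 m ^+ 2).
Proof.
move=> Zv tT; have tT' := ltnW tT.
have := is_proj_dotv (@Z_convex m) (z_step m tT) (Zv m).
have := dotv_three_points (v m) (z t m) (z t.+1 m).
have := h_sup (Xx tT) (Zz tT m) (Zv m).
have := dotv_le (- (zeta t m - zeta t.-1 m)) (z t.+1 m - z t m).
rewrite enormN -/(dz t.+1 m).
have := ler_wpM2r (enorm_ge0 (z t.+1 m - z t m)) (zeta_lip m tT').
rewrite -/(dz t.+1 m).
set w := enorm (zeta t m - _) * _ => w1 w2 hsup tri proj.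
(* Young's inequality is applied to the [E2] part only; the [E1] part stays a product, to be summed
   over [m] by [cross_term_le]. *)
have lw : lam m * w <= lam m * E1 m * dx t * dz t.+1 m
    + E / 2 * (dz t m ^+ 2 + dz t.+1 m ^+ 2).
  have := ler_wpM2l (lam_ge0 m) w1.
  rewrite mulrDl mulrDr !mulrA => /le_trans; apply; rewrite lerD2l.
  have sq := sqr_ge0 (dz t m - dz t.+1 m).
  have b0 : 0 <= dz t m * dz t.+1 m by rewrite mulr_ge0 ?enorm_ge0.
  have E0 : 0 <= E by apply: le_trans (E_ge m); rewrite mulr_ge0.
  have := ler_wpM2r b0 (E_ge m); have := mulr_ge0 E0 sq.
  by rewrite sqrrB; lra.
have zp : lam m * dotv (2 *: zeta t m - zeta t.-1 m) (z t.+1 m - v m) <=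
    1 / (2 * delta) * (enorm (v m - z t m) ^+ 2 - enorm (v m - z t.+1 m) ^+ 2
                       - dz t.+1 m ^+ 2).
  rewrite mul1r ler_pdivlMl ?mulr_gt0// /dz -tri.
  move: proj; rewrite -[z t.+1 m - v m]opprB -[z t.+1 m - z t m]opprB.
  rewrite addrAC.
  move: (z t m - _) (v m - _) (2 *: _ - _) => a b c.
  by rewrite dotvDl !dotvNl !dotvNr dotvZl; lra.
suff : lam m * (h (x t.+1) (v m) - h (x t.+1) (z t.+1 m)) <=
  lam m * dotv (2 *: zeta t m - zeta t.-1 m) (z t.+1 m - v m)
    + lam m * (W v t.+1 m - W v t m) + lam m * w by lra.
rewrite -!mulrDr ler_wpM2l// lerBlDl; apply: le_trans hsup _; rewrite lerD2l.
rewrite -[Hz _ _]opprK -/(zeta t.+1 m).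
apply: le_trans (lerD (lexx _) w2).
rewrite /W /= !dotvE; lra.
Qed.

(** The projected point minimizes over [X] the linearization plus both quadratics, centred at [xk]
    and [x t]. Its optimality condition and two three-point identities give the bound. *)
Lemma primal_step u t : X u -> (t < T)%N ->
  dotv (G (x t) + \sum_(m < M) lam m *: Hx (x t) (z t.+1 m)) (x t.+1 - u) <=
    1 / (2 * alpha) * (enorm (u - xk) ^+ 2 - enorm (u - x t.+1) ^+ 2
                       - enorm (x t.+1 - xk) ^+ 2)
    + 1 / (2 * gamma) * (enorm (u - x t) ^+ 2 - enorm (u - x t.+1) ^+ 2
                       - dx t.+1 ^+ 2).
Proof.
move=> Xu tT; have := is_proj_dotv X_convex (x_step tT) Xu.
move: (G _ + _) => g proj.
rewrite -!dotv_three_points !mul1r !invfM.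
have {}proj : dotv (alpha^-1 *: (xk - x t.+1) + gamma^-1 *: (x t - x t.+1) - g)
    (u - x t.+1) <= 0.
  have k0 : 0 < alpha * gamma / (alpha + gamma).
    by rewrite divr_gt0 ?mulr_gt0 ?addr_gt0.
  rewrite -(pmulr_rle0 _ k0) -dotvZl; move: proj; congr (dotv _ _ <= 0).
  set k := alpha * gamma / (alpha + gamma).
  (* The scaling [k] makes the weights of [xk] and [x t] sum to 1, so x_(t+1) can be subtracted
     inside the bracket. *)
  have e : k * (alpha^-1 + gamma^-1) = 1.
    rewrite /k; field; rewrite !gt_eqF// addr_gt0//.
  rewrite -[X in _ - X]scale1r -e -scalerA -scalerBr; congr (_ *: _).
  by apply/rowP => i; rewrite !mxE; ring.
move: proj; rewrite !dotvE; lra.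
Qed.

(* The potential carries the terms that telescope: the extrapolation error
   [W], the distances to the comparison point and the part of the last step
   lengths that pays for the next gradient variation. *)
Let Pot u v t :=
  \sum_(m < M) lam m * W v t m
  - 1 / (2 * gamma) * enorm (u - x t) ^+ 2
  - 1 / (2 * delta) * \sum_(m < M) enorm (v m - z t m) ^+ 2
  - S / 2 * dx t ^+ 2 - E / 2 * \sum_(m < M) dz t m ^+ 2.

(** With z_(t+1) fixed, descent from x_t to x_(t+1) and convexity from x_t to [u] handle the primal
    part; [dual_step] summed over [m] replaces z_(t+1) by [v] at x_(t+1). *)
Lemma gap_le_potential u v t : X u -> prodset Z v -> (t < T)%N ->
  L (x t.+1) v - L u (z t.+1) + 1 / (2 * alpha) * enorm (u - x t.+1) ^+ 2
    <= Pot u v t.+1 - Pot u v t.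
Proof.
move=> Xu Zv tT; have tT' := ltnW tT.
have dual : \sum_(m < M) lam m * h (x t.+1) (v m)
    - \sum_(m < M) lam m * h (x t.+1) (z t.+1 m) <=
    1 / (2 * delta) * (\sum_(m < M) enorm (v m - z t m) ^+ 2
      - \sum_(m < M) enorm (v m - z t.+1 m) ^+ 2 - \sum_(m < M) dz t.+1 m ^+ 2)
    + (\sum_(m < M) lam m * W v t.+1 m - \sum_(m < M) lam m * W v t m)
    + \sum_(m < M) lam m * E1 m * dx t * dz t.+1 m
    + E / 2 * (\sum_(m < M) dz t m ^+ 2 + \sum_(m < M) dz t.+1 m ^+ 2).
  rewrite -!sumrB -!big_split/= !mulr_sumr -!big_split/=.
  by apply: ler_sum => m _; rewrite -!mulrBr; exact: dual_step.
have cross := @cross_term_le (dx t) (dz t.+1) (enorm_ge0 _).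
have := primal_step Xu tT.
have := coupled_descent_le (Zz tT) (Xx tT') (Xx tT).
have := coupled_sub (Zz tT) (Xx tT') Xu.
move: (G _ + _) => xi.
rewrite -[enorm (x t.+1 - x t)]/(dx t.+1).
have -> : dotv xi (x t.+1 - u) = dotv xi (x t.+1 - x t) - dotv xi (u - x t).
  by rewrite -dotvNr -dotvDr opprB addrA subrK.
move=> sub desc prim.
(* Of the available 1 / (2 gamma), one part pays for the descent error and S / 2 is stored in [Pot]
   for the cross term of the next iteration. *)
have gam : (D0 + \sum_(m < M) lam m * D m) / 2 * dx t.+1 ^+ 2 <=
    (1 / (2 * gamma) - S / 2) * dx t.+1 ^+ 2.
  rewrite ler_wpM2r ?sqr_ge0// invfM mul1r.
  have : D0 + \sum_(m < M) lam m * D m + S <= gamma^-1.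
    by rewrite -[gamma^-1]mulr1 ler_pdivlMl.
  lra.
(* E / 2 pays for the current Young term, S / 2 for the cross term, and another E / 2 is stored in
   [Pot]. *)
have del : (E + S / 2) * \sum_(m < M) dz t.+1 m ^+ 2 <=
    1 / (2 * delta) * \sum_(m < M) dz t.+1 m ^+ 2.
  rewrite ler_wpM2r ?sumr_ge0// => [m _|]; first exact: sqr_ge0.
  rewrite invfM mul1r.
  have : 2 * E + S <= delta^-1 by rewrite -[delta^-1]mulr1 ler_pdivlMl.
  lra.
rewrite /L /Pot; lra.
Qed.

(** Jensen's inequality passes from the averages to the iterates, the gaps telescope to Pot(T) -
    Pot(0), and the diameters bound what remains uniformly in [T], [u] and [v]. *)
Lemma saddle_gap u v (dX : R) (dZ : 'I_M -> R) : X u -> prodset Z v ->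
  (0 < T)%N ->
  (forall a b, X a -> X b -> enorm (a - b) <= dX) ->
  (forall m a b, Z m a -> Z m b -> enorm (a - b) <= dZ m) ->
  T%:R * (L (xavg T x) v - L u (zavg T z)
          + 1 / (2 * alpha) * enorm (u - xavg T x) ^+ 2) <=
  \sum_(m < M) lam m * ((E1 m * dX + E2 m * dZ m) * dZ m)
    + 1 / (2 * gamma) * dX ^+ 2 + 1 / (2 * delta) * \sum_(m < M) dZ m ^+ 2.
Proof.
move=> Xu Zv T0 dXP dZP.
have Xavg : X (xavg T x) by apply: convex_xavg => // t /andP[_]; exact: Xx.
have Zavg : prodset Z (zavg T z).
  by move=> m; apply: convex_xavg => // t /andP[_] tT; exact: Zz.
(* The vector [v] supplied here is the gradient of the squared distance to [c] at the average. *)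
have sqavg (c : 'rV[R]_N) : T%:R * enorm (xavg T x - c) ^+ 2 <=
    \sum_(1 <= t < T.+1) enorm (x t - c) ^+ 2.
  apply: (avg_grad_le (p := fun y => enorm (y - c) ^+ 2)
    (v := 2 *: (xavg T x - c))) => // t _.
  rewrite dotvZl -lerBrDl.
  have := dotv_three_points (x t) c (xavg T x).
  by have := sqr_ge0 (enorm (x t - xavg T x)); lra.
have pavg : T%:R * p (xavg T x) <= \sum_(1 <= t < T.+1) p (x t).
  apply: (avg_grad_le (v := G (xavg T x))) => // t /andP[_ tT].
  by apply: p_sub => //; exact: Xx.
have havg m : T%:R * h (xavg T x) (v m) <= \sum_(1 <= t < T.+1) h (x t) (v m).
  apply: (avg_grad_le (p := fun y => h y (v m))
    (v := Hx (xavg T x) (v m))) => //.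
  by move=> t /andP[_ tT]; apply: h_sub => //; exact: Xx.
have gavg m : T%:R * - h u (zavg T z m) <= \sum_(1 <= t < T.+1) - h u (z t m).
  apply: (avg_grad_le (p := fun y => - h u y)
    (v := - Hz u (zavg T z m))) => // t /andP[_ tT].
  by rewrite dotvNl -opprD lerN2; apply: h_sup => //; exact: Zz.
have avg : T%:R * (L (xavg T x) v - L u (zavg T z)
          + 1 / (2 * alpha) * enorm (u - xavg T x) ^+ 2) <=
    \sum_(1 <= t < T.+1) (L (x t) v - L u (z t)
          + 1 / (2 * alpha) * enorm (u - x t) ^+ 2).
  rewrite /L.
  have a0 : 0 <= 1 / (2 * alpha) by rewrite divr_ge0// mulr_ge0// ltW.
  have H1 : T%:R * \sum_(m < M) lam m * h (xavg T x) (v m) <=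
      \sum_(1 <= t < T.+1) \sum_(m < M) lam m * h (x t) (v m).
    rewrite exchange_big mulr_sumr/= ler_sum// => m _.
    by rewrite -mulr_sumr mulrCA ler_wpM2l.
  have H2 : T%:R * - (\sum_(m < M) lam m * h u (zavg T z m)) <=
      \sum_(1 <= t < T.+1) - \sum_(m < M) lam m * h u (z t m).
    have neg (w : forall m, 'rV[R]_(J m)) : - \sum_(m < M) lam m * h u (w m) =
        \sum_(m < M) lam m * - h u (w m).
      by rewrite -sumrN; apply: eq_bigr => m _; rewrite mulrN.
    rewrite neg (eq_bigr _ (fun t _ => neg (z t))).
    rewrite exchange_big mulr_sumr/= ler_sum// => m _.
    by rewrite -mulr_sumr mulrCA ler_wpM2l.
  have S1 := sqavg xk; have := sqavg u.
  rewrite -enormN opprB; under eq_bigr do rewrite -enormN opprB.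
  move=> S2.
  rewrite big_split big_split/= big_split/= big_split/= -!mulr_sumr.
  rewrite sumrN !big_split/=.
  have := ler_wpM2l a0 S1; have := ler_wpM2l a0 S2.
  have cst c : \sum_(1 <= t < T.+1) c = T%:R * c :> R.
    by rewrite sumr_const_nat subSS subn0 mulr_natl.
  rewrite !cst; rewrite sumrN in H2.
  lra.
apply: le_trans avg _.
have tel : \sum_(1 <= t < T.+1) (L (x t) v - L u (z t)
    + 1 / (2 * alpha) * enorm (u - x t) ^+ 2) <= Pot u v T - Pot u v 0.
  rewrite -(telescope_sumr (Pot u v)) ?leq0n// big_add1/=.
  by apply: ler_sum_nat => t tT; exact: gap_le_potential.
apply: le_trans tel _.
have S0 : 0 <= S by rewrite S_def sqrtr_ge0.
(* At time T only the [W] terms can be positive; at time 0 only the distances from (u, v) to the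
   starting point survive. *)
have Wle : \sum_(m < M) lam m * W v T m <=
    \sum_(m < M) lam m * ((E1 m * dX + E2 m * dZ m) * dZ m).
  apply: ler_sum => m _; rewrite ler_wpM2l//.
  apply: le_trans (dotv_le _ _) _.
  rewrite ler_pM ?enorm_ge0//; last by apply: dZP => //; exact: Zz.
  apply: le_trans (zeta_lip _ _) _ => //.
  have pT : (T.-1 <= T)%N := leq_pred T.
  rewrite lerD// ler_wpM2l//.
    by apply: dXP; exact: Xx.
  by apply: dZP; exact: Zz.
have Xle : enorm (u - x 0) ^+ 2 <= dX ^+ 2.
  by apply: enorm_sq_le; apply: dXP => //; exact: Xx.
have Zle : \sum_(m < M) enorm (v m - z 0 m) ^+ 2 <= \sum_(m < M) dZ m ^+ 2.
  by apply: ler_sum => m _; apply: enorm_sq_le; apply: dZP => //; exact: Zz.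
have E0 : 0 <= E * \sum_(m < M) dz T m ^+ 2.
  rewrite mulr_sumr sumr_ge0// => m _; rewrite mulr_ge0 ?sqr_ge0//.
  by apply: le_trans (E_ge m); rewrite mulr_ge0.
have dx0 : dx 0 = 0 by rewrite /dx subrr enorm0.
have dz0 : \sum_(m < M) dz 0 m ^+ 2 = 0.
  by apply: big1 => m _; rewrite /dz subrr enorm0 expr0n.
have W0 : \sum_(m < M) lam m * W v 0 m = 0.
  by apply: big1 => m _; rewrite /W subrr dotv0l mulr0.
have g0 : 0 <= 1 / (2 * gamma) by rewrite divr_ge0// mulr_ge0// ltW.
have d0 : 0 <= 1 / (2 * delta) by rewrite divr_ge0// mulr_ge0// ltW.
rewrite /Pot dx0 dz0 W0.
have := ler_wpM2l g0 Xle; have := ler_wpM2l d0 Zle.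
have := mulr_ge0 g0 (sqr_ge0 (enorm (u - x T))).
have := mulr_ge0 d0 (sumr_ge0 _ (fun m _ => sqr_ge0 (enorm (v m - z T m)))
  : 0 <= \sum_(m < M) _).
have := mulr_ge0 S0 (sqr_ge0 (dx T)).
rewrite expr0n /=; lra.
Qed.

End Run.
End PrimalDual.

(** * From joint differentiability to partial gradients, and negation *)

Section Differentiability.
Context {R : realType}.

Lemma differentiable_on_near (V : normedModType R) (f : V -> \bar R)
    (A : set V) (x : V) : differentiable_on f A -> A x ->
  (\forall y \near x, f y \is a fin_num) /\
  differentiable (fun y => fine (f y) : R^o) x.
Proof.
move=> [U [oU AU Uf dU]] Ax; split; last exact/dU/AU.
by apply: filterS Uf _; apply: open_nbhs_nbhs; split => //; exact: AU.
Qed.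

(** Composition with the embeddings y -> (y, z) and w -> (x, w). *)
Lemma differentiable_on_sections (V W : normedModType R) (g : V -> W -> \bar R)
    (A : set V) (B : set W) (x : V) (z : W) :
  differentiable_on (fun q : V * W => g q.1 q.2) (A `*` B) -> A x -> B z ->
  [/\ \forall y \near x, g y z \is a fin_num,
      differentiable (fun y => fine (g y z) : R^o) x,
      \forall w \near z, g x w \is a fin_num &
      differentiable (fun w => fine (g x w) : R^o) z].
Proof.
move=> /differentiable_on_near dg Ax Bz.
have [fg d] := dg (x, z) (conj Ax Bz).
have cx : (fun y => (y, z)) @ x --> (x, z).
  by apply: cvg_pair; [exact: cvg_id|exact: cvg_cst].
have cz : (fun w => (x, w)) @ z --> (x, z).
  by apply: cvg_pair; [exact: cvg_cst|exact: cvg_id].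
split; [exact: cx fg| |exact: cz fg| ].
- exact: (@differentiable_comp _ _ _ _ (fun y => (y, z))
    (fun q : V * W => fine (g q.1 q.2) : R^o)).
- exact: (@differentiable_comp _ _ _ _ (fun w => (x, w))
    (fun q : V * W => fine (g q.1 q.2) : R^o)).
Qed.

Lemma gradN n (f : 'rV[R]_n -> \bar R) (x : 'rV[R]_n) :
  differentiable (fun y => fine (f y) : R^o) x ->
  grad (fun y => - f y)%E x = - grad f x.
Proof.
move=> df; apply/rowP => i; rewrite !mxE -deriveN; last exact: diff_derivable.
by congr ('D_ _ _ x); apply/funext => y; rewrite fineN.
Qed.

Lemma differentiable_fineN n (f : 'rV[R]_n -> \bar R) (x : 'rV[R]_n) :
  differentiable (fun y => fine (f y) : R^o) x ->
  differentiable (fun y => fine (- f y)%E : R^o) x.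
Proof.
move=> df; rewrite (_ : (fun y => _) = - (fun y => fine (f y) : R^o)).
  exact: differentiableN.
by apply/funext => y; rewrite fineN.
Qed.

End Differentiability.

(* The bound on delta is stated in extended reals, where the inverse of 0 is
   +oo: its denominator vanishes when lam = 0. The constant C may depend on
   the step sizes, but not on nu, T, the starting points or the subgradients. *)
Theorem theorem3 (R : realType) (N M : nat) (J : 'I_M -> nat)
    (X : set 'rV[R]_N) (Z : forall m : 'I_M, set 'rV[R]_(J m))
    (f0 : 'rV[R]_N -> \bar R)
    (g : forall m : 'I_M, 'rV[R]_N -> 'rV[R]_(J m) -> \bar R)
    (D0 : R) (D E1 E2 : 'I_M -> R)
    (X_nonempty : X !=set0) (X_compact : compact X) (X_convex : convex_set X)
    (Z_nonempty : forall m, Z m !=set0)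
    (Z_compact : forall m, compact (Z m))
    (Z_convex : forall m, convex_set (Z m))
    (f0_gtNy : forall x, (-oo < f0 x)%E)
    (f0_convex : econvex f0)
    (f0_dom : X `<=` edom f0)
    (g_convex : forall m zm, Z m zm -> econvex (fun x => g m x zm))
    (g_concave : forall m x, X x -> econcave (g m x))
    (g_dom : forall m, X `*` Z m `<=` edom (fun p => g m p.1 p.2))
    (slater : exists2 xbar, X xbar &
       forall m, (max_over (g m) (Z m) xbar < 0)%E)
    (has_optimal : exists xs, optimal_solution f0 (feasible X Z g) xs)
    (f0_diff : differentiable_on f0 X)
    (g_diff : forall m,
       differentiable_on
         (fun p : 'rV[R]_N * 'rV[R]_(J m) => g m p.1 p.2) (X `*` Z m))
    (D0_gt0 : 0 < D0) (D_gt0 : forall m, 0 < D m)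
    (E1_gt0 : forall m, 0 < E1 m) (E2_gt0 : forall m, 0 < E2 m)
    (f0_smooth : forall x x', X x -> X x' ->
       enorm (grad f0 x - grad f0 x') <= D0 * enorm (x - x'))
    (gx_smooth : forall m zm x x', Z m zm -> X x -> X x' ->
       enorm (grad (fun y => g m y zm) x - grad (fun y => g m y zm) x')
         <= D m * enorm (x - x'))
    (gz_smooth : forall m zm zm' x x', Z m zm -> Z m zm' -> X x -> X x' ->
       enorm (grad (g m x) zm - grad (g m x') zm')
         <= E1 m * enorm (x - x') + E2 m * enorm (zm - zm'))
    (alpha : R) (xk : 'rV[R]_N) (lam : 'I_M -> R)
    (alpha_gt0 : 0 < alpha) (xk_X : X xk) (lam_ge0 : forall m, 0 <= lam m)
    (gamma delta : R) (gamma_gt0 : 0 < gamma) (delta_gt0 : 0 < delta)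
    (gamma_le : gamma <=
       1 / (D0 + \sum_(m < M) lam m * D m
            + Num.sqrt (2 * \sum_(m < M) (lam m * E1 m) ^+ 2)))
    (delta_le : (delta%:E <=
       1 / (2 * Num.sqrt 2 * \big[Num.max/0%R]_(m < M) (lam m * E2 m)
            + Num.sqrt (2 * \sum_(m < M) (lam m * E1 m) ^+ 2))%R%:E)%E) :
  exists2 C : R, 0 < C &
    forall (nu : R) (T : nat) (x : nat -> 'rV[R]_N)
           (z : nat -> forall m, 'rV[R]_(J m)),
      0 < nu -> (1 <= T)%N -> C / nu <= T%:R ->
      inner_run X Z f0 g alpha xk lam gamma delta T x z ->
      strong_saddle (inner_objective f0 g alpha xk lam) (1 / alpha)
        X (prodset Z) nu (xavg T x) (zavg T z).
Proof.
(* The finite parts and their gradients instantiate the abstract data of [saddle_gap]. *)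
pose p y := fine (f0 y); pose G := grad f0.
pose h m y zm := fine (g m y zm).
pose Hx m y zm := grad (fun y' => g m y' zm) y.
pose Hz m y zm := grad (g m y) zm.
pose S := Num.sqrt (\sum_(m < M) (lam m * E1 m) ^+ 2).
pose E := \big[Num.max/0%R]_(m < M) (lam m * E2 m).
have S0 : 0 <= S by exact: sqrtr_ge0.
have S_le : S <= Num.sqrt (2 * \sum_(m < M) (lam m * E1 m) ^+ 2).
  have sq0 : 0 <= \sum_(m < M) (lam m * E1 m) ^+ 2.
    by apply: sumr_ge0 => m _; exact: sqr_ge0.
  by rewrite ler_sqrt ?mulr_ge0//; lra.
have E0 : 0 <= E by exact: bigmax_ge_id.
have E_ge m : lam m * E2 m <= E by exact: le_bigmax.
have f0_fin y : X y -> f0 y \is a fin_num by exact: f0_dom.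
have g_fin m y zm : X y -> Z m zm -> g m y zm \is a fin_num.
  by move=> Xy Zzm; apply: (g_dom m (y, zm)).
have p_sub y y' : X y -> X y' -> p y + dotv (G y) (y' - y) <= p y'.
  move=> Xy Xy'; have [fin dif] := differentiable_on_near f0_diff Xy.
  by apply: econvex_grad_le => //; exact: f0_fin.
have h_sub m zm y y' : Z m zm -> X y -> X y' ->
    h m y zm + dotv (Hx m y zm) (y' - y) <= h m y' zm.
  move=> Zzm Xy Xy'.
  have [fin dif _ _] := differentiable_on_sections (g_diff m) Xy Zzm.
  by apply: (econvex_grad_le (f := fun y => g m y zm)) => //;
    [exact: g_convex|exact: g_fin].
have finN m y zm : X y -> Z m zm ->
    \forall w \near zm, (- g m y w)%E \is a fin_num.
  move=> Xy Zzm.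
  have [_ _ fin _] := differentiable_on_sections (g_diff m) Xy Zzm.
  by apply: filterS fin => w; rewrite fin_numN.
have h_sup m y zm w : X y -> Z m zm -> Z m w ->
    h m y w <= h m y zm + dotv (Hz m y zm) (w - zm).
  move=> Xy Zzm Zw.
  have [_ _ _ dif] := differentiable_on_sections (g_diff m) Xy Zzm.
  have := econvex_grad_le (finN _ _ _ Xy Zzm) (differentiable_fineN dif)
    (y := w) (g_concave m y Xy).
  rewrite fin_numN g_fin// => /(_ isT).
  rewrite !fineN gradN// dotvNl -opprD lerN2.
  exact.
have D_ge0 : 0 <= \sum_(m < M) lam m * D m.
  by apply: sumr_ge0 => m _; rewrite mulr_ge0// ltW.
have gamma_small : gamma * (D0 + \sum_(m < M) lam m * D m + S) <= 1.
  have := gamma_le; rewrite ler_pdivlMr; last by lra.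
  by apply: le_trans; rewrite ler_pM2l// lerD2l.
have delta_small : delta * (2 * E + S) <= 1.
  move: delta_le; rewrite -/E; set d := 2 * Num.sqrt 2 * E + _ => delta_le.
  have Ed : 2 * E + S <= d.
    rewrite lerD// ler_wpM2r// ler_peMr// -[leLHS]sqrtr1 ler_sqrt//.
    by rewrite ler1n.
  apply: le_trans (ler_wpM2l (ltW delta_gt0) Ed) _.
  (* If d = 0 the extended bound on [delta] is vacuous, but the product is 0. *)
  have [->|dn0] := eqVneq d 0; first by rewrite mulr0.
  have d0 : 0 < d by rewrite lt0r dn0 (le_trans _ Ed)// addr_ge0// mulr_ge0.
  move: delta_le; rewrite inver (negbTE dn0) mul1e lee_fin.
  by rewrite -ler_pdivlMr// div1r.
have [dX dX0 dXP] := compact_enorm_bounded X_compact.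
have [dZ dZP] : exists dZ : 'I_M -> R, forall m, 0 <= dZ m /\
    forall a b, Z m a -> Z m b -> enorm (a - b) <= dZ m.
  have /choice[dZ dZP] : forall m, exists d : R, 0 <= d /\
      forall a b, Z m a -> Z m b -> enorm (a - b) <= d.
    move=> m; have [d d0 dP] := compact_enorm_bounded (Z_compact m).
    by exists d.
  by exists dZ.
pose K := \sum_(m < M) lam m * ((E1 m * dX + E2 m * dZ m) * dZ m)
    + 1 / (2 * gamma) * dX ^+ 2 + 1 / (2 * delta) * \sum_(m < M) dZ m ^+ 2.
have K0 : 0 <= K.
  apply: addr_ge0; first apply: addr_ge0.
  - apply: sumr_ge0 => m _; have [dz0 _] := dZP m.
    by rewrite !mulr_ge0// addr_ge0// mulr_ge0// ltW.
  - by rewrite mulr_ge0 ?sqr_ge0// divr_ge0// mulr_ge0// ltW.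
  - apply: mulr_ge0; first by rewrite divr_ge0// mulr_ge0// ltW.
    by apply: sumr_ge0 => m _; exact: sqr_ge0.
(* [K] can be 0, for instance when all the sets are singletons; adding 1 makes the constant
   positive. *)
exists (K + 1); first by rewrite ltr_wpDl.
move=> nu T x z nu0 T0 TC [Xx0 Zz0 [zeta [xi0 [xi run]]]].
have Xx t : (t <= T)%N -> X (x t).
  by case: t => [//|t] tT; have [_ _ _ _ []] := run _ tT.
have Zz t : (t <= T)%N -> prodset Z (z t).
  by case: t => [//|t] tT m; have [_ /(_ m)[]] := run _ tT.
(* Differentiability leaves no choice of subgradient, so the run is the gradient iteration. *)
have zetaE t m : (t < T)%N -> zeta t m = - Hz m (x t) (z t m).
  move=> tT; have [/(_ m) sub _ _ _ _] := run _ tT.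
  have Xt := Xx _ (ltnW tT); have Zt := Zz _ (ltnW tT) m.
  have [_ _ _ dif] := differentiable_on_sections (g_diff m) Xt Zt.
  rewrite -(gradN dif).
  by apply: subdiff_grad => //; [exact: finN|exact: differentiable_fineN].
have z_step t m : (t < T)%N -> is_proj (Z m)
    (z t m - (delta * lam m) *:
       (2 *: - Hz m (x t) (z t m) - - Hz m (x t.-1) (z t.-1 m))) (z t.+1 m).
  move=> tT; have [_ /(_ m) + _ _ _] := run _ tT.
  by rewrite !zetaE//; apply: leq_ltn_trans (leq_pred t) tT.
have x_step t : (t < T)%N -> is_proj X
    ((alpha * gamma / (alpha + gamma)) *: (alpha^-1 *: xk + gamma^-1 *: x t
      - (G (x t) + \sum_(m < M) lam m *: Hx m (x t) (z t.+1 m)))) (x t.+1).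
  move=> tT; have [_ _ sub0 sub proj] := run _ tT; have Xt := Xx _ (ltnW tT).
  have [fin dif] := differentiable_on_near f0_diff Xt.
  rewrite /G -(subdiff_grad fin dif sub0).
  rewrite (eq_bigr (fun m => lam m *: xi t m))// => m _.
  have [fing difg _ _] := differentiable_on_sections (g_diff m) Xt (Zz _ tT m).
  by rewrite (subdiff_grad (f := fun y => g m y (z t.+1 m)) fing difg (sub m)).
split.
- by apply: convex_xavg => // t /andP[_]; exact: Xx.
- by move=> m; apply: convex_xavg => // t /andP[_] tT; exact: Zz.
move=> u v Xu Zv.
have dZ_le m := (dZP m).2.
have := saddle_gap X_convex Z_convex p_sub h_sub h_sup f0_smooth gx_smooth
  gz_smooth (fun m => ltW (E1_gt0 m)) (fun m => ltW (E2_gt0 m)) lam_ge0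
  alpha_gt0 gamma_gt0 delta_gt0 (erefl S) E_ge gamma_small delta_small
  Xx Zz z_step x_step Xu Zv T0 dXP dZ_le.
rewrite -/K => gap.
(* (K + 1) / nu <= T gives K <= T nu; dividing by T then leaves [nu], with the quadratic coefficient
   1 / (2 alpha) equal to sigma / 2. *)
have {}gap : T%:R * (inner_objective f0 g alpha xk lam (xavg T x) v
    - inner_objective f0 g alpha xk lam u (zavg T z)
    + 1 / (2 * alpha) * enorm (u - xavg T x) ^+ 2) <= T%:R * nu.
  apply: le_trans gap _; move: TC; rewrite ler_pdivrMr//; lra.
move: gap; rewrite ler_pM2l ?ltr0n// invfM mul1r div1r; lra.
Qed.
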